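(* Let $\Omega$ be a bounded domain, $\epsilon>0$, $\psi\in C(\Gamma_\epsilon)$ and $\varphi$ continuous on $\Omega_\epsilon\times[-\epsilon^2/2,\epsilon^2/2]$. For $T>\epsilon^2$ define the continuous function $F$ on $\Gamma_{\epsilon,T}$ by $F(x,t)=\psi(x)$ for $(x,t)\in\Gamma_\epsilon\times(\epsilon^2,T]$; $F(x,t)=\varphi(x,\epsilon^2/2)+\frac{2(t-\epsilon^2/2)}{\epsilon^2}\big(\psi(x)-\varphi(x,\epsilon^2/2)\big)$ for $(x,t)\in\Gamma_\epsilon\times(\epsilon^2/2,\epsilon^2]$; $F(x,t)=\varphi(x,t)$ for $(x,t)\in\Omega_\epsilon\times[-\epsilon^2/2,\epsilon^2/2]$ (where this lies in $\Gamma_{\epsilon,T}$). Let $u_\epsilon$ denote the bounded function satisfying $u_\epsilon(x,t)=(1-\delta(x,t))\operatorname{midrange}_{\nu\in S^{n-1}}\mathscr{A}_\epsilon u_\epsilon(x,t-\epsilon^2/2;\nu)+\delta(x,t)F(x,t)$ on $\Omega_{\epsilon,T}$ (this function does not depend on $T$ on common domains, so it is defined for all $t>-\epsilon^2/2$). Then for $x\in\Omega$, $$\lim_{T\to\infty}u_\epsilon(x,T)=U_\epsilon(x),$$ where $U_\epsilon$ is the (unique bounded) function on $\Omega_\epsilon$ satisfying $$U_\epsilon(x)=(1-\overline\delta(x))\operatorname{midrange}_{\nu\in S^{n-1}}\Big[\alpha U_\epsilon(x+\epsilon\nu)+\beta\fint_{B^\nu_\epsilon}U_\epsilon(x+h)\,d\mathcal{L}^{n-1}(h)\Big]+\overline\delta(x)\psi(x),$$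 with $\overline\delta=\lim_{t\to\infty}\delta(\cdot,t)$, i.e. $\overline\delta=0$ on $\Omega\setminus I_\epsilon$, $\overline\delta(x)=1-\operatorname{dist}(x,\partial\Omega)/\epsilon$ on $I_\epsilon$, $\overline\delta=1$ on $O_\epsilon$.
   Context: $\alpha,\beta\in(0,1)$ with $\alpha+\beta=1$. Notation: $I_\epsilon=\{x\in\Omega:\operatorname{dist}(x,\partial\Omega)<\epsilon\}$, $O_\epsilon=\{x\in\mathbb{R}^n\setminus\overline\Omega:\operatorname{dist}(x,\partial\Omega)<\epsilon\}$, $\Gamma_\epsilon=I_\epsilon\cup O_\epsilon\cup\partial\Omega$, $\Omega_\epsilon=\overline\Omega\cup O_\epsilon$; $\Omega_T=\Omega\times(0,T]$, $\partial_p\Omega_T=(\overline\Omega\times\{0\})\cup(\partial\Omega\times(0,T])$; $I_{\epsilon,T}=\{(x,t)\in\Omega\times[\epsilon^2/2,T]:\operatorname{dist}(x,\partial\Omega)<\epsilon\}\cup(\Omega\times(0,\epsilon^2/2))$; $O_{\epsilon,T}=\{(x,t)\in(\mathbb{R}^n\setminus\overline\Omega)\times(0,T]:\operatorname{dist}(x,\partial\Omega)<\epsilon\}\cup(\Omega_\epsilon\times(-\epsilon^2/2,0))$; $\Gamma_{\epsilon,T}=I_{\epsilon,T}\cup O_{\epsilon,T}\cup\partial_p\Omega_T$; $\Omega_{\epsilon,T}=\overline\Omega_T\cup O_{\epsilon,T}$. $\delta=0$ on $\Omega_T\setminus I_{\epsilon,T}$, $\delta(x,t)=\min\{1,1-\operatorname{dist}(x,\partial\Omega)/\epsilon\}\cdot\min\{1,1-\sqrt{2t}/\epsilon\}$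 on $I_{\epsilon,T}$, $\delta=1$ on $O_{\epsilon,T}$ (and on $\partial_p\Omega_T$). For $\nu\in S^{n-1}$, $B^\nu_\epsilon=\{h:|h|<\epsilon,\langle h,\nu\rangle=0\}$, $\mathcal{L}^{n-1}$ is $(n-1)$-dimensional Lebesgue measure, $\mathscr{A}_\epsilon u(x,t;\nu)=\alpha u(x+\epsilon\nu,t)+\beta\fint_{B^\nu_\epsilon}u(x+h,t)\,d\mathcal{L}^{n-1}(h)$, $\operatorname{midrange}_iA_i=\frac12(\sup_iA_i+\inf_iA_i)$.
   Formalization: The weight δ on I_{ε,T} is corrected to 1 − min{1, dist(x,∂Ω)/ε}·min{1, √(2t)/ε}, since the printed product tends to −∞ and has no limit δ̄ = 1 − dist/ε; also n ≥ 2, and u_ε(·,t), U_ε are taken Borel and u_ε bounded uniformly in T. *)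

(* Defs.v *)
From HB Require Import structures.
From mathcomp Require Import all_boot all_order all_algebra.
From mathcomp Require Import all_classical all_reals all_analysis.
Set Implicit Arguments. Unset Strict Implicit. Unset Printing Implicit Defensive.
Import Order.TTheory GRing.Theory Num.Theory.
Import numFieldNormedType.Exports.
Local Open Scope classical_set_scope.
Local Open Scope ring_scope.

Definition dotp (R : realType) (n : nat) (u v : 'rV[R]_n) : R :=
  \sum_(i < n) u 0 i * v 0 i.
Definition enorm (R : realType) (n : nat) (u : 'rV[R]_n) : R :=
  Num.sqrt (dotp u u).

Definition sphere (R : realType) (n : nat) : set 'rV[R]_n :=
  [set v | enorm v = 1].

Definition dist (R : realType) (n : nat) (x : 'rV[R]_n) (A : set 'rV[R]_n) : R :=
  inf [set enorm (x - y) | y in A].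

Definition bdry (R : realType) (n : nat) (A : set 'rV[R]_n) : set 'rV[R]_n :=
  closure A `\` interior A.

Definition Ieps (R : realType) n (Om : set 'rV[R]_n) (eps : R) : set 'rV[R]_n :=
  [set x | Om x /\ dist x (bdry Om) < eps].
Definition Oeps (R : realType) n (Om : set 'rV[R]_n) (eps : R) : set 'rV[R]_n :=
  [set x | ~ closure Om x /\ dist x (bdry Om) < eps].
Definition Gammaeps (R : realType) n (Om : set 'rV[R]_n) (eps : R) : set 'rV[R]_n :=
  Ieps Om eps `|` Oeps Om eps `|` bdry Om.
Definition Omegaeps (R : realType) n (Om : set 'rV[R]_n) (eps : R) : set 'rV[R]_n :=
  closure Om `|` Oeps Om eps.

Definition OmegaT (R : realType) n (Om : set 'rV[R]_n) (T : R) : set ('rV[R]_n * R) :=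
  [set p | Om p.1 /\ 0 < p.2 <= T].
Definition parbdry (R : realType) n (Om : set 'rV[R]_n) (T : R) : set ('rV[R]_n * R) :=
  [set p | (closure Om p.1 /\ p.2 = 0) \/ (bdry Om p.1 /\ 0 < p.2 <= T)].
Definition IepsT (R : realType) n (Om : set 'rV[R]_n) (eps T : R) : set ('rV[R]_n * R) :=
  [set p | (Om p.1 /\ eps ^+ 2 / 2 <= p.2 <= T /\ dist p.1 (bdry Om) < eps)
        \/ (Om p.1 /\ 0 < p.2 < eps ^+ 2 / 2)].
Definition OepsT (R : realType) n (Om : set 'rV[R]_n) (eps T : R) : set ('rV[R]_n * R) :=
  [set p | (~ closure Om p.1 /\ dist p.1 (bdry Om) < eps /\ 0 < p.2 <= T)
        \/ (Omegaeps Om eps p.1 /\ - (eps ^+ 2 / 2) < p.2 < 0)].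
Definition GammaepsT (R : realType) n (Om : set 'rV[R]_n) (eps T : R) : set ('rV[R]_n * R) :=
  IepsT Om eps T `|` OepsT Om eps T `|` parbdry Om T.
Definition OmegaepsT (R : realType) n (Om : set 'rV[R]_n) (eps T : R) : set ('rV[R]_n * R) :=
  closure (OmegaT Om T) `|` OepsT Om eps T.

Definition delta (R : realType) n (Om : set 'rV[R]_n) (eps T : R) (x : 'rV[R]_n) (t : R) : R :=
  if (x, t) \in IepsT Om eps T then
    1 - Num.min 1 (dist x (bdry Om) / eps) * Num.min 1 (Num.sqrt (2 * t) / eps)
  else if (x, t) \in OepsT Om eps T `|` parbdry Om T then 1 else 0.

(* stationary weight: limit of delta(., t) as t -> oo *)
Definition deltabar (R : realType) n (Om : set 'rV[R]_n) (eps : R) (x : 'rV[R]_n) : R :=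
  if x \in Ieps Om eps then 1 - dist x (bdry Om) / eps
  else if x \in Oeps Om eps `|` bdry Om then 1 else 0.

Definition Fdat (R : realType) n (eps : R) (psi : 'rV[R]_n -> R) (phi : 'rV[R]_n -> R -> R)
    (x : 'rV[R]_n) (t : R) : R :=
  if eps ^+ 2 < t then psi x
  else if eps ^+ 2 / 2 < t then
    phi x (eps ^+ 2 / 2) + 2 * (t - eps ^+ 2 / 2) / eps ^+ 2 * (psi x - phi x (eps ^+ 2 / 2))
  else phi x t.

(* ---- k-dimensional Lebesgue integral, as an iterated one-dimensional
        Lebesgue integral (Fubini) ---- *)
Fixpoint iint (R : realType) (k : nat) : ('rV[R]_k -> R) -> R :=
  match k return ('rV[R]_k -> R) -> R with
  | 0 => fun f => f 0
  | k'.+1 => fun f =>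
      Rintegral (@lebesgue_measure R) setT
        (fun a : R => @iint R k' (fun y : 'rV[R]_k' => f (row_mx (const_mx a : 'rV[R]_1) y : 'rV[R]_(1 + k'))))
  end.

Definition emb (R : realType) (n : nat) (y : 'rV[R]_n.-1) : 'rV[R]_n :=
  \row_(i < n) (if @insub _ (fun k => (k < n.-1)%N) ('I_n.-1) (val i) is Some j then y 0 j else 0).

Definition elast (R : realType) (n : nat) : 'rV[R]_n :=
  \row_(i < n) (if val i == n.-1 then 1 else 0).

(* Householder reflection mapping e_n to nu: an orthogonal map carrying the
   hyperplane e_n^perp = R^{n-1} x {0} isometrically onto nu^perp *)
Definition hh (R : realType) (n : nat) (nu : 'rV[R]_n) (z : 'rV[R]_n) : 'rV[R]_n :=
  let w := elast R n - nu in
  if w == 0 then z else z - (2 * dotp z w / dotp w w) *: w.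

(* mean value over the (n-1)-dimensional disc B^nu_eps w.r.t. L^{n-1} *)
Definition favg (R : realType) (n : nat) (eps : R) (nu : 'rV[R]_n) (g : 'rV[R]_n -> R) : R :=
  iint (fun y : 'rV[R]_n.-1 => ((enorm y < eps)%R : bool)%:R * g (hh nu (emb y)))
  / iint (fun y : 'rV[R]_n.-1 => ((enorm y < eps)%R : bool)%:R).

Definition midrange (R : realType) (A : set R) : R := (sup A + inf A) / 2.

Definition Aeps (R : realType) n (alpha beta eps : R) (u : 'rV[R]_n -> R -> R)
    (x : 'rV[R]_n) (t : R) (nu : 'rV[R]_n) : R :=
  alpha * u (x + eps *: nu) t + beta * favg eps nu (fun h => u (x + h) t).

Definition borel_on (R : realType) n (D : set 'rV[R]_n) (f : 'rV[R]_n -> R) : Prop :=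
  forall B : set R, measurable B ->
    <<s [set O : set 'rV[R]_n | open O] >> (D `&` f @^-1` B).

(* Main.v *)
(** The barrier [v x = 2 K - exp (lam |x|^2)] is a strict supersolution of the
    averaging step, uniformly in the direction [nu]: as the mean of a linear form
    over the disc vanishes and that of [|h|^2] is a positive constant,
    [exp s >= 1 + s] shows that for a suitable [lam] the [beta]-part alone doubles
    [exp (lam |x|^2)], so that one step maps [v] below [kappa * v] with
    [kappa < 1]. Since the midrange is 1-Lipschitz for the sup distance, the
    stationary dynamic programming operator therefore contracts the weighted norm
    [sup |w| / v] by the factor [kappa]. For [t > eps^2] the parabolic weights and
    data are the stationary ones, so that each time step [eps^2 / 2] applies this
    operator and [u - U] decays geometrically. *)
Require Import Defs.
From HB Require Import structures.
From mathcomp Require Import all_boot all_order all_algebra.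
From mathcomp Require Import all_classical all_reals all_analysis.
From mathcomp Require Import measurable_realfun ring lra.
Set Implicit Arguments. Unset Strict Implicit. Unset Printing Implicit Defensive.
Import Order.TTheory GRing.Theory Num.Theory.
Import numFieldNormedType.Exports.
Local Open Scope classical_set_scope.
Local Open Scope ring_scope.

HB.instance Definition _ (R : realType) n :=
  @isMeasurable.Build (sigma_display (@open 'rV[R]_n)) 'rV[R]_n
    <<s @open 'rV[R]_n >> (@sigma_algebra0 _ setT _) (@sigma_algebraC _ _)
    (@sigma_algebra_bigcup _ setT _).

Section borel_row_vectors.
Context {R : realType}.

Lemma open_measurable_rV n (O : set 'rV[R]_n) : open O -> measurable O.
Proof. exact: sub_sigma_algebra. Qed.

Lemma continuous_measurable_rV n (f : 'rV[R]_n -> R) :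
  continuous f -> measurable_fun setT f.
Proof.
move=> /continuousP cf; apply: (measurability _ (RGenOpens.measurableE R)).
move=> _ [_ [a [b ->]] <-]; rewrite setTI.
by apply: open_measurable_rV; apply: cf; exact: interval_open.
Qed.

Lemma measurable_coord n (i : 'I_n) :
  measurable_fun setT (fun x : 'rV[R]_n => x 0 i).
Proof. by apply: continuous_measurable_rV; exact: coord_continuous. Qed.

Definition rat_box n (ab : 'rV[rat]_n * 'rV[rat]_n) : set 'rV[R]_n :=
  [set y | forall i, y 0 i \in `]ratr (ab.1 0 i), ratr (ab.2 0 i)[].

Lemma nbhs_rat_itv (x : R) (A : set R) : nbhs x A ->
  exists ab : rat * rat,
    (x \in `]ratr ab.1, ratr ab.2[) /\ `]ratr ab.1, ratr ab.2[ `<=` A.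
Proof.
move=> /nbhs_ballP[e /= e0 eA].
have [|a] := @rat_in_itvoo R (x - e) x; first by rewrite ltrBlDr ltrDl.
have [|b] := @rat_in_itvoo R x (x + e); first by rewrite ltrDl.
rewrite !in_itv/= => /andP[xb be] /andP[ae ax].
exists (a, b); rewrite in_itv/= ax xb; split=> // y /=.
rewrite in_itv/= => /andP[ay yb]; apply: eA; rewrite /ball/= ltr_distlC.
by rewrite (lt_trans ae ay) (lt_trans yb be).
Qed.

Lemma nbhs_rat_box n (x : 'rV[R]_n) (A : set 'rV[R]_n) : nbhs x A ->
  exists2 ab, rat_box ab x & rat_box ab `<=` A.
Proof.
move=> [B xB BA]; pose ab i := cid (nbhs_rat_itv (xB 0 i)).
exists (\row_i (sval (ab i)).1, \row_i (sval (ab i)).2) => [i|y abx].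
  by rewrite !mxE; case: (svalP (ab i)).
apply: BA => i j; rewrite !ord1; case: (svalP (ab j)) => _; apply.
by have := abx j; rewrite !mxE.
Qed.

Lemma measurable_preimage_rat_box {d} {T : measurableType d} n
    (f : T -> 'rV[R]_n) ab :
  (forall i, measurable_fun setT (fun t => f t 0 i)) ->
  measurable (f @^-1` rat_box ab).
Proof.
move=> mf; rewrite [X in measurable X](_ : _ = \bigcap_(i in setT)
    (fun t => f t 0 i) @^-1` `]ratr (ab.1 0 i), ratr (ab.2 0 i)[); last first.
  by apply/seteqP; split=> t /= ft i; [move=> _|]; exact: ft.
apply: fin_bigcap_measurable => // i _; rewrite -[X in measurable X]setTI.
exact: mf.
Qed.

Lemma measurable_fun_rVP {d} {T : measurableType d} n (f : T -> 'rV[R]_n) :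
  measurable_fun setT f <->
  forall i, measurable_fun setT (fun t => f t 0 i).
Proof.
split=> [mf i|mf]; first exact: (measurableT_comp (measurable_coord i) mf).
apply: (@measurability _ _ _ _ _ _ (@open 'rV[R]_n)) => // _ [A oA <-].
rewrite setTI (_ : f @^-1` A = \bigcup_ab
    f @^-1` (if `[< rat_box ab `<=` A >] then rat_box ab else set0)).
  apply: countable_bigcupT_measurable => // ab; case: asboolP => _.
    exact: measurable_preimage_rat_box.
  by rewrite preimage_set0.
apply/seteqP; split=> t /=; last first.
  by case=> ab _; case: asboolP => // abA /abA.
move=> Aft; have [ab abt abA] := nbhs_rat_box (open_nbhs_nbhs (conj oA Aft)).
by exists ab => //=; rewrite asboolT.
Qed.

Lemma borel_onP n (D : set 'rV[R]_n) (f : 'rV[R]_n -> R) :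
  borel_on D f <-> measurable D /\ measurable_fun D f.
Proof.
split=> [bf|[mD mf] B mB]; last exact: mf.
by split; [rewrite -[D]setIT; exact: (bf setT)|move=> _ B; exact: bf].
Qed.

Lemma measurable_addrv n (x : 'rV[R]_n) : measurable_fun setT (+%R x).
Proof.
apply/measurable_fun_rVP => i; under eq_fun do rewrite mxE.
by apply: measurable_funD => //; exact: measurable_coord.
Qed.

Lemma measurable_dotp n (x : 'rV[R]_n) : measurable_fun setT (dotp x).
Proof.
apply: measurable_sum => i; apply: measurable_funM => //.
exact: measurable_coord.
Qed.

Lemma measurable_dotpxx n : measurable_fun setT (fun x : 'rV[R]_n => dotp x x).
Proof.
by apply: measurable_sum => i; apply: measurable_funM; exact: measurable_coord.
Qed.

Lemma measurable_hh n (nu : 'rV[R]_n) : measurable_fun setT (hh nu).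
Proof.
rewrite /hh /=; case: (elast R n - nu == 0) => //.
apply/measurable_fun_rVP => i; under eq_fun do rewrite !mxE.
apply: measurable_funB; first exact: measurable_coord.
do 3 (apply: measurable_funM => //).
apply: measurable_sum => j; apply: measurable_funM => //.
exact: measurable_coord.
Qed.

Lemma measurable_emb n : measurable_fun setT (@emb R n).
Proof.
apply/measurable_fun_rVP => i; under eq_fun do rewrite mxE.
by case: insub => [j|]; [exact: measurable_coord|exact: measurable_cst].
Qed.

End borel_row_vectors.

Definition cons_rv {R : realType} {k} (a : R) (y : 'rV[R]_k) : 'rV[R]_k.+1 :=
  row_mx (const_mx a : 'rV[R]_1) y.

Definition box {R : realType} {k} (a b : R) : set 'rV[R]_k :=
  [set y | forall i, y 0 i \in `[a, b]].

Section iterated_integral.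
Context {R : realType}.
Local Notation mu := (@lebesgue_measure R).

Lemma cons_rv0 k (a : R) (y : 'rV[R]_k) : cons_rv a y 0 ord0 = a.
Proof.
have := row_mxEl (const_mx a : 'rV[R]_1) y 0 ord0; rewrite [RHS]mxE => e.
by rewrite -[RHS]e; congr (row_mx _ _ _ _); apply/val_inj.
Qed.

Lemma cons_rvS k (a : R) (y : 'rV[R]_k) (i : 'I_k) :
  cons_rv a y 0 (lift ord0 i) = y 0 i.
Proof.
rewrite -[RHS](row_mxEr (const_mx a : 'rV[R]_1) y 0 i).
by congr (row_mx _ _ _ _); apply/val_inj.
Qed.

Lemma cons_rvN k (a : R) (y : 'rV[R]_k) : cons_rv (- a) (- y) = - cons_rv a y.
Proof.
apply/rowP => i; rewrite [RHS]mxE.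
by case: (unliftP ord0 i) => [j|] ->; rewrite ?cons_rvS ?cons_rv0 ?mxE.
Qed.

Lemma measurable_cons_rv {d} {T : measurableType d} k
    (f : T -> R) (g : T -> 'rV[R]_k) :
  measurable_fun setT f -> measurable_fun setT g ->
  measurable_fun setT (fun t => cons_rv (f t) (g t)).
Proof.
move=> mf /measurable_fun_rVP mg; apply/measurable_fun_rVP => i.
case: (unliftP ord0 i) => [j|] ->.
  by under eq_fun do rewrite cons_rvS; exact: mg.
by under eq_fun do rewrite cons_rv0.
Qed.

Lemma measurable_box k (a b : R) : measurable (@box R k a b).
Proof.
rewrite (_ : box a b = \bigcap_(i in [set: 'I_k])
    (fun y : 'rV[R]_k => y 0 i) @^-1` `[a, b]); last first.
  by apply/seteqP; split=> y /= yab i; [move=> _|]; exact: yab.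
apply: fin_bigcap_measurable => // i _; rewrite -[X in measurable X]setTI.
exact: measurable_coord.
Qed.

Lemma indic_box_cons k (a b t : R) (y : 'rV[R]_k) :
  \1_(box a b) (cons_rv t y) = \1_`[a, b]%classic t * \1_(box a b) y :> R.
Proof.
rewrite !indicE -natrM mulnb; congr (_%:R); congr nat_of_bool.
apply/idP/andP => [|[]]; rewrite !inE.
  move=> tyab; split=> [|i]; first by have := tyab ord0; rewrite cons_rv0.
  by have := tyab (lift ord0 i); rewrite cons_rvS.
move=> tab yab i.
by case: (unliftP ord0 i) => [j|] ->; rewrite ?cons_rvS ?cons_rv0//; exact: yab.
Qed.

Lemma measurable_fun_Rintegral {d d'} {T1 : measurableType d}
    {T2 : measurableType d'} (m : {sigma_finite_measure set T2 -> \bar R})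
    (f : T1 * T2 -> R) : measurable_fun setT f ->
  measurable_fun setT (fun x => \int[m]_y f (x, y)).
Proof.
move=> mf; have mEf : measurable_fun setT (EFin \o f) by exact/measurable_EFinP.
apply: (measurableT_comp (@fine_measurable R setT measurableT)).
rewrite [X in measurable_fun _ X](_ : _ =
    (fun x => fubini_F m (EFin \o f)^\+ x - fubini_F m (EFin \o f)^\- x)%E);
    last first.
  apply/funext => x; rewrite [LHS]integralE.
  by congr (_ - _)%E; apply: eq_integral => y _; rewrite ?funeposE ?funenegE.
apply: emeasurable_funB; apply: measurable_fun_fubini_tonelli_F => //.
  exact: measurable_funepos.
exact: measurable_funeneg.
Qed.

Lemma integrable_le_indic_itv (f : R -> R) (C a b : R) :
  measurable_fun setT f -> (forall t, `|f t| <= C * \1_`[a, b]%classic t) ->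
  mu.-integrable setT (EFin \o f).
Proof.
move=> mf fC.
have i1 := @integrable_indic_itv R a b true false.
have iC := @integrableZl _ _ _ mu setT measurableT C _ i1.
apply: le_integrable iC => //; first exact/measurable_EFinP.
by move=> t _; rewrite /= lee_fin (le_trans (fC t))// ler_norm.
Qed.

Lemma Rintegral_indic_itv (a b : R) : a <= b ->
  \int[mu]_t \1_`[a, b]%classic t = b - a.
Proof.
move=> ab; rewrite /Rintegral integral_indic//= setIT lebesgue_measure_itv/=.
by rewrite lte_fin; case: ltgtP ab => // ->; rewrite subrr.
Qed.

Lemma norm_Rintegral_le_itv (f : R -> R) (C a b : R) : a <= b ->
  measurable_fun setT f -> (forall t, `|f t| <= C * \1_`[a, b]%classic t) ->
  `|\int[mu]_t f t| <= C * (b - a).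
Proof.
move=> ab mf fC; have fi := integrable_le_indic_itv mf fC.
have i1 := @integrable_indic_itv R a b true false.
apply: le_trans (le_normr_Rintegral _ fi) _ => //.
rewrite -Rintegral_indic_itv// -RintegralZl//.
apply: le_Rintegral => //; first exact: integrable_norm.
exact: (@integrableZl _ _ _ _ setT measurableT C _ i1).
Qed.

Lemma Rintegral_compN (f : R -> R) : mu.-integrable setT (EFin \o f) ->
  \int[mu]_t f (- t) = \int[mu]_t f t.
Proof.
move=> fi; pose opp := (-%R : R -> measurableTypeR R).
have mf : measurable_fun setT f by case/integrableP: fi => /measurable_EFinP.
have mopp : measurable_fun setT opp by exact: oppr_measurable.
have mfopp : measurable_fun setT (EFin \o (f \o opp)).
  by apply/measurable_EFinP; exact: measurableT_comp.
have foppK : EFin \o (f \o opp) \o opp = EFin \o f.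
  by apply/funext => t; rewrite /= /opp opprK.
rewrite /Rintegral; congr fine.
transitivity (\int[pushforward mu opp]_t (EFin \o (f \o opp)) t)%E.
  by apply: eq_measure_integral => A mA _; exact/esym/lebesgue_measureN.
by rewrite integral_pushforward ?foppK.
Qed.

Definition iintable k (f : 'rV[R]_k -> R) : Prop :=
  measurable_fun setT f /\
  exists C a b, a <= b /\ forall y, `|f y| <= C * \1_(box a b) y.

Lemma iintS k (f : 'rV[R]_k.+1 -> R) :
  iint f = \int[mu]_a iint (fun y => f (cons_rv a y)).
Proof. by []. Qed.

Lemma measurable_iint {d} {T : measurableType d} k (f : T * 'rV[R]_k -> R) :
  measurable_fun setT f ->
  measurable_fun setT (fun x => iint (fun y => f (x, y))).
Proof.
elim: k d T f => [|k IH] d T f mf.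
  by apply: (measurableT_comp mf); exact: measurable_fun_pair.
apply: (@measurable_fun_Rintegral _ _ _ _ mu
  (fun xa => iint (fun y => f (xa.1, cons_rv xa.2 y)))).
apply: (IH _ _ (fun xay => f (xay.1.1, cons_rv xay.1.2 xay.2))).
apply: (measurableT_comp mf); apply: measurable_fun_pair.
  exact: measurableT_comp.
by apply: measurable_cons_rv => //; exact: measurableT_comp.
Qed.

Lemma measurable_iint_slice k (f : 'rV[R]_k.+1 -> R) : measurable_fun setT f ->
  measurable_fun setT (fun t => iint (fun y => f (cons_rv t y))).
Proof.
move=> mf; apply: (@measurable_iint _ _ k (fun ty => f (cons_rv ty.1 ty.2))).
by apply: (measurableT_comp mf); exact: measurable_cons_rv.
Qed.

Lemma slice_le_indic_box k (f : 'rV[R]_k.+1 -> R) C a b :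
  (forall y, `|f y| <= C * \1_(box a b) y) ->
  forall t y, `|f (cons_rv t y)| <= C * \1_`[a, b]%classic t * \1_(box a b) y.
Proof. by move=> fC t y; rewrite -mulrA -indic_box_cons. Qed.

Lemma norm_iint_le_box k (f : 'rV[R]_k -> R) (C a b : R) : a <= b ->
  measurable_fun setT f -> (forall y, `|f y| <= C * \1_(box a b) y) ->
  `|iint f| <= C * (b - a) ^+ k.
Proof.
move=> ab; elim: k f C => [|k IH] f C mf fC.
  apply: le_trans (fC 0) _.
  by rewrite expr0 indicE (_ : (0 : 'rV[R]_0) \in _)// inE => -[].
rewrite iintS exprSr mulrA; apply: norm_Rintegral_le_itv => //.
  exact: measurable_iint_slice.
move=> t; rewrite mulrAC; apply: IH; last exact: slice_le_indic_box.
by apply: (measurableT_comp mf); exact: measurable_cons_rv.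
Qed.

Lemma iintable_slice k (f : 'rV[R]_k.+1 -> R) (t : R) :
  iintable f -> iintable (fun y => f (cons_rv t y)).
Proof.
move=> [mf [C [a [b [ab fC]]]]]; split.
  by apply: (measurableT_comp mf); exact: measurable_cons_rv.
exists (C * \1_`[a, b]%classic t), a, b; split=> //.
exact: slice_le_indic_box.
Qed.

Lemma integrable_iint_slice k (f : 'rV[R]_k.+1 -> R) : iintable f ->
  mu.-integrable setT (EFin \o (fun t => iint (fun y => f (cons_rv t y)))).
Proof.
move=> [mf [C [a [b [ab fC]]]]].
apply: (@integrable_le_indic_itv _ (C * (b - a) ^+ k) a b).
  exact: measurable_iint_slice.
move=> t; rewrite mulrAC; apply: norm_iint_le_box => //.
  by apply: (measurableT_comp mf); exact: measurable_cons_rv.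
exact: slice_le_indic_box.
Qed.

Lemma le_iint k (f g : 'rV[R]_k -> R) :
  iintable f -> iintable g -> (forall y, f y <= g y) -> iint f <= iint g.
Proof.
elim: k f g => [|k IH] f g fi gi fg; first exact: fg.
rewrite !iintS; apply: le_Rintegral => //; try exact: integrable_iint_slice.
by move=> a _; apply: IH => //; exact: iintable_slice.
Qed.

Lemma iintD k (f g : 'rV[R]_k -> R) :
  iintable f -> iintable g -> iint (fun y => f y + g y) = iint f + iint g.
Proof.
elim: k f g => [|k IH] f g fi gi //.
rewrite !iintS -RintegralD//; try exact: integrable_iint_slice.
by apply: eq_Rintegral => a _; apply: IH => //; exact: iintable_slice.
Qed.

Lemma iintZ k (c : R) (f : 'rV[R]_k -> R) :
  iintable f -> iint (fun y => c * f y) = c * iint f.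
Proof.
elim: k f => [|k IH] f fi //.
rewrite !iintS -RintegralZl//; last exact: integrable_iint_slice.
by apply: eq_Rintegral => a _; apply: IH => //; exact: iintable_slice.
Qed.

Lemma iint_compN k (f : 'rV[R]_k -> R) :
  iintable f -> iint (fun y => f (- y)) = iint f.
Proof.
elim: k f => [|k IH] f fi; first by rewrite /= oppr0.
rewrite !iintS -[RHS]Rintegral_compN; last exact: integrable_iint_slice.
apply: eq_Rintegral => a _ /=.
rewrite -(IH (fun y => f (cons_rv (- a) y))); last exact: iintable_slice.
by congr iint; apply/funext => y; rewrite cons_rvN.
Qed.

Lemma iintable_indic_box k (a b : R) : a <= b -> iintable (\1_(@box R k a b)).
Proof.
move=> ab; split; first by apply/measurable_indicP; exact: measurable_box.
by exists 1, a, b; split=> // y; rewrite mul1r ger0_norm.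
Qed.

Lemma iint_indic_box k (a b : R) : a <= b ->
  iint (\1_(@box R k a b)) = (b - a) ^+ k.
Proof.
move=> ab; elim: k => [|k IH].
  by rewrite /= indicE (_ : (0 : 'rV[R]_0) \in _)// inE => -[].
rewrite iintS exprS -IH -Rintegral_indic_itv// -RintegralZr//; last first.
  exact: integrable_indic_itv.
apply: eq_Rintegral => t _; rewrite -iintZ; last exact: iintable_indic_box.
by congr iint; apply/funext => y; rewrite indic_box_cons.
Qed.

Lemma iintableZ k (c : R) (f : 'rV[R]_k -> R) :
  iintable f -> iintable (fun y => c * f y).
Proof.
move=> [mf [C [a [b [ab fC]]]]]; split; first exact: measurable_funM.
by exists (`|c| * C), a, b; split=> // y; rewrite normrM -mulrA ler_wpM2l.
Qed.

Lemma le_box_iint k (f : 'rV[R]_k -> R) (c a b : R) : a <= b -> iintable f ->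
  (forall y, 0 <= f y) -> (forall y, box a b y -> c <= f y) ->
  c * (b - a) ^+ k <= iint f.
Proof.
move=> ab fi f0 cf; have ib := @iintable_indic_box k _ _ ab.
rewrite -iint_indic_box// -iintZ//; apply: le_iint (iintableZ c ib) fi _ => y.
rewrite indicE; case: (boolP (y \in _)); last by rewrite mulr0.
by rewrite inE mulr1; exact: cf.
Qed.

End iterated_integral.

Section euclidean_row_vectors.
Context {R : realType} {n : nat}.
Implicit Types x y z h nu : 'rV[R]_n.

Lemma dotpC x y : dotp x y = dotp y x.
Proof. by apply: eq_bigr => i _; rewrite mulrC. Qed.

Lemma dotpDr x y z : dotp x (y + z) = dotp x y + dotp x z.
Proof. by rewrite -big_split; apply: eq_bigr => i _; rewrite mxE mulrDr. Qed.

Lemma dotpZr c x y : dotp x (c *: y) = c * dotp x y.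
Proof. by rewrite mulr_sumr; apply: eq_bigr => i _; rewrite mxE mulrCA. Qed.

Lemma dotpNr x y : dotp x (- y) = - dotp x y.
Proof. by rewrite -scaleN1r dotpZr mulN1r. Qed.

Lemma dotpNN x y : dotp (- x) (- y) = dotp x y.
Proof. by rewrite dotpNr dotpC dotpNr opprK dotpC. Qed.

Lemma dotpxxD x h : dotp (x + h) (x + h) = dotp x x + 2 * dotp x h + dotp h h.
Proof. by rewrite dotpDr ![dotp (x + h) _]dotpC !dotpDr (dotpC h x); ring. Qed.

Lemma sqr_coord_le_dotpxx x i : x 0 i ^+ 2 <= dotp x x.
Proof.
rewrite /dotp (bigD1 i)//= -expr2 lerDl.
by apply: sumr_ge0 => j _; rewrite -expr2 sqr_ge0.
Qed.

Lemma dotpxx_ge0 x : 0 <= dotp x x.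
Proof. by apply: sumr_ge0 => i _; rewrite -expr2 sqr_ge0. Qed.

Lemma dotpxx_eq0 x : dotp x x = 0 -> x = 0.
Proof.
move=> x0; apply/rowP => i; rewrite mxE; apply/eqP.
by rewrite -sqrf_eq0 eq_le sqr_ge0 andbT -x0; exact: sqr_coord_le_dotpxx.
Qed.

Lemma norm_dotp_le x h : `|dotp x h| <= dotp x x + dotp h h.
Proof.
have := dotpxx_ge0 (x + h); have := dotpxx_ge0 (x - h).
rewrite !dotpxxD dotpNN dotpNr; have := dotpxx_ge0 x; have := dotpxx_ge0 h.
by rewrite ler_norml => *; apply/andP; split; lra.
Qed.

Lemma dotpxxD_le x h : dotp (x + h) (x + h) <= 3 * (dotp x x + dotp h h).
Proof.
by have := norm_dotp_le x h; rewrite dotpxxD ler_norml => /andP[_]; lra.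
Qed.

Lemma sqr_enorm x : enorm x ^+ 2 = dotp x x.
Proof. by rewrite sqr_sqrtr ?dotpxx_ge0. Qed.

Lemma enorm_ge0 x : 0 <= enorm x.
Proof. exact: sqrtr_ge0. Qed.

Lemma enorm0 : enorm (0 : 'rV[R]_n) = 0.
Proof. by rewrite /enorm /dotp big1 ?sqrtr0// => i _; rewrite mxE mul0r. Qed.

Lemma enormN x : enorm (- x) = enorm x.
Proof. by rewrite /enorm dotpNN. Qed.

Lemma enormZ c x : enorm (c *: x) = `|c| * enorm x.
Proof.
by rewrite /enorm dotpZr dotpC dotpZr mulrA -expr2 sqrtrM ?sqr_ge0// sqrtr_sqr.
Qed.

Lemma dotpxx_lt_sqr x e : 0 < e -> (dotp x x < e ^+ 2) = (enorm x < e).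
Proof. by move=> e0; rewrite -sqr_enorm ltr_pXn2r// nnegrE ?enorm_ge0 ?ltW. Qed.

Lemma dotpxx_le_sqr x e : enorm x <= e -> dotp x x <= e ^+ 2.
Proof.
move=> xe; rewrite -sqr_enorm ler_pXn2r// nnegrE ?enorm_ge0//.
exact: le_trans (enorm_ge0 x) xe.
Qed.

Lemma coord_le_enorm x i : `|x 0 i| <= enorm x.
Proof. by rewrite -sqrtr_sqr ler_wsqrtr// sqr_coord_le_dotpxx. Qed.

Lemma dotp_hh nu z : dotp (hh nu z) (hh nu z) = dotp z z.
Proof.
rewrite /hh; case: eqVneq => // w0; set w := _ - nu in w0 *.
have ww : dotp w w != 0 by apply: contraNneq w0 => /dotpxx_eq0 ->.
by rewrite dotpxxD dotpNN dotpNr !dotpZr (dotpC (_ *: _)) dotpZr; field.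
Qed.

Lemma hhN nu z : hh nu (- z) = - hh nu z.
Proof.
rewrite /hh; case: ifP => // _.
by rewrite dotpC dotpNr dotpC mulrN mulNr scaleNr opprB opprK addrC.
Qed.

End euclidean_row_vectors.

Lemma embN {R : realType} n (y : 'rV[R]_n.-1) : emb (- y) = - emb y.
Proof.
by apply/rowP => i; rewrite !mxE; case: insub => [j|]; rewrite ?mxE ?oppr0.
Qed.

Lemma dotp_emb {R : realType} n (y : 'rV[R]_n.-1) :
  dotp (emb y) (emb y) = dotp y y.
Proof.
case: n y => [|k] y; first by rewrite /dotp !big_ord0.
rewrite /dotp big_ord_recr/= [X in _ + X](_ : _ = 0) ?addr0; last first.
  by rewrite !mxE; case: insubP => [j|]; rewrite ?mulr0//= ltnn.
apply: eq_bigr => i _; rewrite !mxE.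
case: insubP => [j _ ij|/negP[]]; last exact: (ltn_ord i).
by rewrite (_ : j = i)//; exact: val_inj.
Qed.

Lemma enorm_hh_emb {R : realType} n (nu : 'rV[R]_n) (y : 'rV[R]_n.-1) :
  enorm (hh nu (emb y)) = enorm y.
Proof. by rewrite /enorm dotp_hh dotp_emb. Qed.

Lemma sphere_elast {R : realType} n : (0 < n)%N -> sphere (elast R n).
Proof.
case: n => // k _; rewrite /sphere/= /enorm /dotp (bigD1 ord_max)//= big1.
  by rewrite !mxE/= eqxx mulr1 addr0 sqrtr1.
move=> i im; rewrite !mxE/=; case: eqVneq => [ik|]; last by rewrite mulr0.
by case/eqP: im; exact: val_inj.
Qed.

Definition eball {R : realType} {n} (e : R) : set 'rV[R]_n :=
  [set h | enorm h < e].

Lemma box_sub_eball {R : realType} k (a b e : R) :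
  0 <= a -> 0 < b -> k.+1%:R * b <= e -> box a b `<=` @eball R k e.
Proof.
move=> a0 b0 be y yab.
have e0 : 0 < e by apply: lt_le_trans be; rewrite mulr_gt0.
rewrite /eball/= -dotpxx_lt_sqr//.
have : dotp y y <= \sum_(i < k) b ^+ 2.
  apply: ler_sum => i _; have := yab i; rewrite in_itv/= => /andP[ay yb].
  by rewrite -expr2 ler_pXn2r// nnegrE ?(le_trans a0 ay)// ltW.
move=> /le_lt_trans; apply; rewrite sumr_const card_ord -mulr_natl.
apply: (@lt_le_trans _ _ ((k.+1%:R * b) ^+ 2)); last first.
  by rewrite ler_pXn2r// nnegrE ?ltW// mulr_gt0.
rewrite exprMn ltr_pM2r ?exprn_gt0// -natrX ltr_nat.
by rewrite (@leq_trans (k.+1 ^ 1))// leq_pexp2l.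
Qed.

Definition bounded_borel {R : realType} {n} (D : set 'rV[R]_n)
    (f : 'rV[R]_n -> R) : Prop :=
  borel_on D f /\ exists C : R, forall x, D x -> `|f x| <= C.

Section bounded_borel_functions.
Context {R : realType} {n : nat}.
Implicit Types (D : set 'rV[R]_n) (f g : 'rV[R]_n -> R).

Lemma measurable_eball (e : R) : 0 < e -> measurable (@eball R n e).
Proof.
move=> e0; rewrite (_ : eball e = (fun x => dotp x x) @^-1` `]-oo, e ^+ 2[).
  by rewrite -[X in measurable X]setTI; apply: measurable_dotpxx.
by apply/seteqP; split=> h; rewrite /= in_itv/= dotpxx_lt_sqr.
Qed.

Lemma bounded_borel_cst D c : measurable D -> bounded_borel D (fun=> c).
Proof.
move=> mD; split; last by exists `|c|.
by apply/borel_onP; split=> //; exact: measurable_cst.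
Qed.

Lemma bounded_borelD D f g : bounded_borel D f -> bounded_borel D g ->
  bounded_borel D (fun x => f x + g x).
Proof.
move=> [/borel_onP[mD mf] [C fC]] [/borel_onP[_ mg] [C' gC']]; split.
  by apply/borel_onP; split=> //; exact: measurable_funD.
exists (C + C') => x Dx.
by rewrite (le_trans (ler_normD _ _))// lerD ?fC ?gC'.
Qed.

Lemma bounded_borelZ D c f : bounded_borel D f ->
  bounded_borel D (fun x => c * f x).
Proof.
move=> [/borel_onP[mD mf] [C fC]]; split.
  by apply/borel_onP; split=> //; exact: measurable_funM.
by exists (`|c| * C) => x Dx; rewrite normrM ler_wpM2l// fC.
Qed.

Lemma bounded_borel_dotp (e : R) (x : 'rV[R]_n) : 0 < e ->
  bounded_borel (eball e) (dotp x).
Proof.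
move=> e0; split.
  apply/borel_onP; split; first exact: measurable_eball.
  by apply: measurable_funTS; exact: measurable_dotp.
exists (dotp x x + e ^+ 2) => h /ltW /dotpxx_le_sqr he.
by rewrite (le_trans (norm_dotp_le x h))// lerD2l.
Qed.

Lemma bounded_borel_dotpxx (e : R) : 0 < e ->
  bounded_borel (@eball R n e) (fun h => dotp h h).
Proof.
move=> e0; split.
  apply/borel_onP; split; first exact: measurable_eball.
  by apply: measurable_funTS; exact: measurable_dotpxx.
by exists (e ^+ 2) => h /ltW /dotpxx_le_sqr he; rewrite ger0_norm ?dotpxx_ge0.
Qed.

Lemma bounded_borel_shift D (e : R) (x : 'rV[R]_n) f : 0 < e ->
  (forall h, enorm h < e -> D (x + h)) ->
  bounded_borel D f -> bounded_borel (eball e) (fun h => f (x + h)).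
Proof.
move=> e0 xD [/borel_onP[mD mf] [C fC]]; split; last first.
  by exists C => h /xD; exact: fC.
apply/borel_onP; split; first exact: measurable_eball.
apply: (measurable_comp mD _ mf); first by move=> _ [h he <-]; exact: xD.
by apply: measurable_funTS; exact: measurable_addrv.
Qed.

End bounded_borel_functions.

Section disc_mean.
Context {R : realType} {n : nat}.
Variables (eps : R) (nu : 'rV[R]_n).
Hypothesis eps_gt0 : 0 < eps.
Implicit Types (g : 'rV[R]_n -> R) (y : 'rV[R]_n.-1).

Definition disc_integrand g y : R :=
  ((enorm y < eps)%R : bool)%:R * g (hh nu (emb y)).

Let favgE g :
  favg eps nu g = iint (disc_integrand g) / iint (disc_integrand (fun=> 1)).
Proof.
rewrite /favg; congr (iint _ / iint _).
by apply/funext => y; rewrite /disc_integrand mulr1.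
Qed.

Lemma le_disc_integrand g1 g2 : (forall h, enorm h < eps -> g1 h <= g2 h) ->
  forall y, disc_integrand g1 y <= disc_integrand g2 y.
Proof.
move=> g12 y; rewrite /disc_integrand; case: ltP => ye; last by rewrite !mul0r.
by rewrite !mul1r g12// enorm_hh_emb.
Qed.

Lemma measurable_disc_integrand g : measurable_fun (eball eps) g ->
  measurable_fun setT (disc_integrand g).
Proof.
move=> mg; rewrite (_ : disc_integrand g =
    (fun y => g (hh nu (emb y))) \_ (eball eps)).
  apply: (measurable_restrictT _ (measurable_eball eps_gt0)).1.
  apply: (measurable_comp (measurable_eball eps_gt0) _ mg).
    by move=> _ [y ye <-]; rewrite /eball/= enorm_hh_emb.
  apply: measurable_funTS.
  exact: measurableT_comp (measurable_hh nu) (@measurable_emb R n).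
apply/funext => y; rewrite patchE /disc_integrand; case: ifPn.
  by rewrite inE /eball/= => ->; rewrite mul1r.
by rewrite notin_setE /eball/= => /negP/negbTE ->; rewrite mul0r.
Qed.

Lemma iintable_disc_integrand g : bounded_borel (eball eps) g ->
  iintable (disc_integrand g).
Proof.
move=> [/borel_onP[_ mg] [C gC]]; split; first exact: measurable_disc_integrand.
exists C, (- eps), eps; split=> [|y]; first by rewrite ge0_cp// ltW.
rewrite /disc_integrand; case: ltP => ye; last first.
  rewrite mul0r normr0 mulr_ge0// (le_trans (normr_ge0 (g 0)))// gC//.
  by rewrite /eball/= enorm0.
rewrite mul1r indicE mem_set ?mulr1.
  by apply: gC; rewrite /eball/= enorm_hh_emb.
by move=> i; rewrite in_itv/= -ler_norml (le_trans (coord_le_enorm y i))// ltW.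
Qed.

Lemma iint_disc_integrand_gt0 g c a b : bounded_borel (eball eps) g ->
  a < b -> box a b `<=` @eball R n.-1 eps -> 0 < c ->
  (forall h, enorm h < eps -> 0 <= g h) ->
  (forall y, box a b y -> c <= g (hh nu (emb y))) ->
  0 < iint (disc_integrand g).
Proof.
move=> bg ab ab_eps c0 g0 cg.
have p0 : 0 < c * (b - a) ^+ n.-1 by rewrite mulr_gt0// exprn_gt0// subr_gt0.
apply: (lt_le_trans p0); apply: le_box_iint; first exact: ltW.
- exact: iintable_disc_integrand.
- move=> y; have := le_disc_integrand g0 y; apply: le_trans.
  by rewrite /disc_integrand mulr0.
- by move=> y yab; rewrite /disc_integrand (ab_eps _ yab) mul1r cg.
Qed.

Let r := eps / n.-1.+1%:R.

Let r_gt0 : 0 < r. Proof. by rewrite divr_gt0. Qed.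

Let r2_lt : r / 2 < r.
Proof. by rewrite ltr_pdivrMr// mulr_natr mulr2n ltrDl. Qed.

Let box_eball : box (r / 2) r `<=` @eball R n.-1 eps.
Proof.
apply: box_sub_eball => //; first by rewrite divr_ge0// ltW.
by rewrite /r mulrC divfK.
Qed.

Lemma disc_mass_gt0 : 0 < iint (disc_integrand (fun=> 1)).
Proof.
apply: (@iint_disc_integrand_gt0 _ 1 (r / 2) r) => //.
by apply: bounded_borel_cst; exact: measurable_eball.
Qed.

Lemma le_favg g1 g2 : bounded_borel (eball eps) g1 ->
  bounded_borel (eball eps) g2 ->
  (forall h, enorm h < eps -> g1 h <= g2 h) -> favg eps nu g1 <= favg eps nu g2.
Proof.
move=> b1 b2 g12; rewrite !favgE ler_pM2r ?invr_gt0 ?disc_mass_gt0//.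
by apply: le_iint (le_disc_integrand g12); exact: iintable_disc_integrand.
Qed.

Lemma favgD g1 g2 : bounded_borel (eball eps) g1 ->
  bounded_borel (eball eps) g2 ->
  favg eps nu (fun h => g1 h + g2 h) = favg eps nu g1 + favg eps nu g2.
Proof.
move=> b1 b2; rewrite !favgE -mulrDl -iintD; try exact: iintable_disc_integrand.
by congr (iint _ / _); apply/funext => y; rewrite /disc_integrand mulrDr.
Qed.

Lemma favgZ c g : bounded_borel (eball eps) g ->
  favg eps nu (fun h => c * g h) = c * favg eps nu g.
Proof.
move=> bg; rewrite !favgE mulrA -iintZ; last exact: iintable_disc_integrand.
by congr (iint _ / _); apply/funext => y; rewrite /disc_integrand mulrCA.
Qed.

Lemma favg_cst c : favg eps nu (fun=> c) = c.
Proof.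
transitivity (favg eps nu (fun=> c * 1)); first by rewrite mulr1.
rewrite favgZ; last by apply: bounded_borel_cst; exact: measurable_eball.
by rewrite favgE divff ?mulr1// gt_eqF// disc_mass_gt0.
Qed.

Lemma favg_odd g : bounded_borel (eball eps) g -> (forall h, g (- h) = - g h) ->
  favg eps nu g = 0.
Proof.
move=> bg gN; have ig := iintable_disc_integrand bg; rewrite favgE.
suff : iint (disc_integrand g) = - iint (disc_integrand g).
  by move/eqP; rewrite -addr_eq0 -mulr2n mulrn_eq0 => /eqP ->; rewrite mul0r.
rewrite -[LHS]iint_compN// -mulN1r -iintZ//.
congr iint; apply/funext => y.
by rewrite /disc_integrand embN hhN gN enormN mulN1r mulrN.
Qed.

Lemma favg_dotpxx_gt0 : (2 <= n)%N -> 0 < favg eps nu (fun h => dotp h h).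
Proof.
rewrite -ltn_predRL => n1; rewrite favgE divr_gt0 ?disc_mass_gt0//.
apply: (@iint_disc_integrand_gt0 _ ((r / 2) ^+ 2) (r / 2) r) => //.
- exact: bounded_borel_dotpxx.
- by rewrite exprn_gt0// divr_gt0.
- by move=> h _; exact: dotpxx_ge0.
move=> y yr; rewrite dotp_hh dotp_emb.
apply: le_trans (sqr_coord_le_dotpxx y (Ordinal n1)).
have := yr (Ordinal n1); rewrite in_itv/= => /andP[ry _].
have r20 : 0 <= r / 2 by rewrite divr_ge0// ltW.
by rewrite ler_pXn2r// nnegrE// (le_trans r20).
Qed.

End disc_mean.

Lemma favg_dotpxx_indep {R : realType} n (eps : R) (nu nu' : 'rV[R]_n) :
  favg eps nu (fun h => dotp h h) = favg eps nu' (fun h => dotp h h).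
Proof. by congr (iint _ / _); apply/funext => y; rewrite !dotp_hh. Qed.

Definition mean_step {R : realType} {n} (alpha beta eps : R)
    (f : 'rV[R]_n -> R) (x nu : 'rV[R]_n) : R :=
  alpha * f (x + eps *: nu) + beta * favg eps nu (fun h => f (x + h)).

Section averaging_step.
Context {R : realType} {n : nat}.
Variables (alpha beta eps : R).
Hypotheses (alpha_gt0 : 0 < alpha) (beta_gt0 : 0 < beta).
Hypotheses (alphaDbeta : alpha + beta = 1) (eps_gt0 : 0 < eps).
Variables (x nu : 'rV[R]_n).
Hypothesis nu_sphere : sphere nu.
Implicit Types f g v : 'rV[R]_n -> R.

Local Notation step f := (mean_step alpha beta eps f x nu).
Local Notation regular f := (bounded_borel (eball eps) (fun h => f (x + h))).

Lemma mean_step_cst c : step (fun=> c) = c.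
Proof. by rewrite /mean_step favg_cst// -mulrDl alphaDbeta mul1r. Qed.

Lemma mean_stepD f g : regular f -> regular g ->
  step (fun y => f y + g y) = step f + step g.
Proof. by move=> rf rg; rewrite /mean_step favgD// !mulrDr addrACA. Qed.

Lemma mean_stepZ c f : regular f -> step (fun y => c * f y) = c * step f.
Proof. by move=> rf; rewrite /mean_step favgZ// mulrDr !(mulrCA c). Qed.

Lemma le_mean_step f g : regular f -> regular g ->
  (forall h, enorm h <= eps -> f (x + h) <= g (x + h)) -> step f <= step g.
Proof.
move=> rf rg fg; rewrite lerD// ler_pM2l//.
  by apply: fg; rewrite enormZ nu_sphere mulr1 gtr0_norm.
by apply: le_favg => // h /ltW; exact: fg.
Qed.

Lemma norm_mean_step_le f C : regular f ->
  (forall h, enorm h <= eps -> `|f (x + h)| <= C) -> `|step f| <= C.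
Proof.
move=> rf fC; have rC c : regular (fun=> c).
  by apply: bounded_borel_cst; exact: measurable_eball.
rewrite ler_norml -[X in X <= _ <= _]mean_step_cst.
rewrite -[X in _ <= _ <= X]mean_step_cst.
by apply/andP; split; apply: le_mean_step => // h /fC;
  rewrite ler_norml => /andP[].
Qed.

Lemma mean_stepB_le f g v m : regular f -> regular g -> regular v ->
  (forall h, enorm h <= eps -> f (x + h) <= g (x + h) + m * v (x + h)) ->
  step f - step g <= m * step v.
Proof.
move=> rf rg rv fgv; have rmv := bounded_borelZ m rv.
rewrite lerBlDl -mean_stepZ// -mean_stepD//; apply: le_mean_step => //.
exact: bounded_borelD.
Qed.

Lemma dist_mean_step_le f g v m : regular f -> regular g -> regular v ->
  (forall h, enorm h <= eps -> `|f (x + h) - g (x + h)| <= m * v (x + h)) ->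
  `|step f - step g| <= m * step v.
Proof.
move=> rf rg rv fgv; rewrite ler_norml lerNl opprB; apply/andP; split;
  apply: mean_stepB_le => // h /fgv; rewrite ler_norml => /andP[]; lra.
Qed.

End averaging_step.

Section midrange_theory.
Context {R : realType} {T : Type}.
Variables (P : set T) (e : R).
Hypothesis P_neq0 : P !=set0.
Implicit Types F G : T -> R.

Lemma le_sup_image F G : has_ubound (G @` P) ->
  (forall z, P z -> F z <= G z + e) -> sup (F @` P) <= sup (G @` P) + e.
Proof.
move=> uG FG; apply: ge_sup; first exact: image_nonempty.
move=> _ [z Pz <-]; apply: le_trans (FG z Pz) _; rewrite lerD2r.
by apply: ub_le_sup => //; exists z.
Qed.

Lemma le_inf_image F G : has_lbound (F @` P) ->
  (forall z, P z -> F z <= G z + e) -> inf (F @` P) <= inf (G @` P) + e.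
Proof.
move=> lF FG; rewrite -lerBlDr; apply: lb_le_inf; first exact: image_nonempty.
move=> _ [z Pz <-]; rewrite lerBlDr; apply: le_trans (FG z Pz).
by apply: ge_inf => //; exists z.
Qed.

Lemma le_midrange_image F G :
  has_lbound (F @` P) -> has_ubound (G @` P) ->
  (forall z, P z -> F z <= G z + e) ->
  midrange (F @` P) <= midrange (G @` P) + e.
Proof.
move=> lF uG FG; have := le_sup_image uG FG; have := le_inf_image lF FG.
by rewrite /midrange; lra.
Qed.

Lemma dist_midrange_image_le F G :
  (exists C, forall z, P z -> `|F z| <= C) ->
  (exists C, forall z, P z -> `|G z| <= C) ->
  (forall z, P z -> `|F z - G z| <= e) ->
  `|midrange (F @` P) - midrange (G @` P)| <= e.
Proof.
have bnd (H : T -> R) : (exists C, forall z, P z -> `|H z| <= C) ->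
    has_lbound (H @` P) /\ has_ubound (H @` P).
  by move=> [C HC]; split; [exists (- C)|exists C] => _ [z Pz <-];
    have := HC z Pz; rewrite ler_norml => /andP[].
move=> /bnd[lF uF] /bnd[lG uG] FGe.
have FG z : P z -> F z <= G z + e /\ G z <= F z + e.
  by move=> /FGe; rewrite ler_norml => /andP[]; split; lra.
have := le_midrange_image lF uG (fun z Pz => (FG z Pz).1).
have := le_midrange_image lG uF (fun z Pz => (FG z Pz).2).
by rewrite ler_norml => *; apply/andP; split; lra.
Qed.

End midrange_theory.

Lemma dist_midrange_mean_step_le {R : realType} {n} (alpha beta eps m e : R)
    (D : set 'rV[R]_n) (f g v : 'rV[R]_n -> R) (x : 'rV[R]_n) :
  (0 < n)%N -> 0 < alpha -> 0 < beta -> alpha + beta = 1 -> 0 < eps ->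
  (forall h, enorm h <= eps -> D (x + h)) ->
  bounded_borel D f -> bounded_borel D g ->
  bounded_borel (eball eps) (fun h => v (x + h)) ->
  (forall h, enorm h <= eps -> `|f (x + h) - g (x + h)| <= m * v (x + h)) ->
  (forall nu, sphere nu -> m * mean_step alpha beta eps v x nu <= e) ->
  `|midrange [set mean_step alpha beta eps f x nu | nu in @sphere R n]
    - midrange [set mean_step alpha beta eps g x nu | nu in @sphere R n]| <= e.
Proof.
move=> n0 a0 b0 ab1 e0 xD bf bg rv fgv ve.
have reg w : bounded_borel D w ->
    bounded_borel (eball eps) (fun h => w (x + h)).
  by apply: bounded_borel_shift => // h /ltW; exact: xD.
have bounded_step w : bounded_borel D w -> exists C, forall nu,
    sphere nu -> `|mean_step alpha beta eps w x nu| <= C.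
  move=> bw; have [_ [C wC]] := bw; exists C => nu nu1.
  by apply: norm_mean_step_le => // [|h /xD]; [exact: reg|exact: wC].
apply: dist_midrange_image_le => [||| nu nu1]; try exact: bounded_step.
  by exists (elast R n); exact: sphere_elast.
apply: le_trans (ve nu nu1).
by apply: dist_mean_step_le => //; exact: reg.
Qed.

Definition exp_sqr {R : realType} {n} (lam : R) (x : 'rV[R]_n) : R :=
  expR (lam * dotp x x).

Section exponential_of_square.
Context {R : realType} {n : nat}.
Variables (eps lam : R).
Hypotheses (eps_gt0 : 0 < eps) (lam_ge0 : 0 <= lam).
Implicit Types x nu : 'rV[R]_n.

Lemma exp_sqr_ge1 x : 1 <= exp_sqr lam x.
Proof. by rewrite -expR0 ler_expR mulr_ge0// dotpxx_ge0. Qed.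

Lemma exp_sqr_shift_le M x h : enorm x <= M -> enorm h <= eps ->
  exp_sqr lam (x + h) <= expR (lam * (3 * (M ^+ 2 + eps ^+ 2))).
Proof.
move=> /dotpxx_le_sqr xM /dotpxx_le_sqr he; rewrite ler_expR ler_wpM2l//.
by rewrite (le_trans (dotpxxD_le _ _))// ler_pM2l// lerD.
Qed.

Lemma bounded_borel_exp_sqr x :
  bounded_borel (eball eps) (fun h => exp_sqr lam (x + h)).
Proof.
split.
  apply/borel_onP; split; first exact: measurable_eball.
  apply: measurable_funTS; apply: (measurableT_comp (@measurable_expR R)).
  apply: measurable_funM => //.
  exact: (measurableT_comp (@measurable_dotpxx R n) (measurable_addrv x)).
exists (expR (lam * (3 * (enorm x ^+ 2 + eps ^+ 2)))) => h /ltW he.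
by rewrite ger0_norm ?expR_ge0//; exact: exp_sqr_shift_le.
Qed.

(* [expR s >= 1 + s], and the part of [|x + h|^2 - |x|^2] that is linear in [h]
   averages to zero. *)
Lemma favg_exp_sqr_ge nu x :
  exp_sqr lam x * (1 + lam * favg eps nu (fun h => dotp h h)) <=
  favg eps nu (fun h => exp_sqr lam (x + h)).
Proof.
have rsq := @bounded_borel_dotpxx R n _ eps_gt0.
have rx := bounded_borel_dotp x eps_gt0.
have rquad :=
  bounded_borelD (bounded_borelZ lam rsq) (bounded_borelZ (2 * lam) rx).
have r1 := bounded_borel_cst 1 (@measurable_eball R n _ eps_gt0).
have -> : exp_sqr lam x * (1 + lam * favg eps nu (fun h => dotp h h)) =
    favg eps nu (fun h => exp_sqr lam x *
      (1 + (lam * dotp h h + 2 * lam * dotp x h))).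
  rewrite favgZ//; last exact: bounded_borelD.
  rewrite favgD// favg_cst// favgD//; try exact: bounded_borelZ.
  rewrite !favgZ// (favg_odd _ eps_gt0 rx) ?mulr0 ?addr0// => h.
  exact: dotpNr.
apply: le_favg => //; first exact/bounded_borelZ/bounded_borelD.
  exact: bounded_borel_exp_sqr.
move=> h _; rewrite {2}/exp_sqr dotpxxD.
have -> : lam * (dotp x x + 2 * dotp x h + dotp h h) =
  lam * dotp x x + (lam * dotp h h + 2 * lam * dotp x h) by ring.
by rewrite expRD ler_pM2l ?expR_gt0// expR_ge1Dx.
Qed.

End exponential_of_square.

Definition thickening {R : realType} {n} (A : set 'rV[R]_n) (e : R) :
    set 'rV[R]_n :=
  [set x + h | x in A & h in [set h | enorm h <= e]].

Record strict_supersolution {R : realType} {n} (alpha beta eps : R)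
    (A : set 'rV[R]_n) (kappa : R) (v : 'rV[R]_n -> R) : Prop := {
  supersolution_regular : forall x, A x ->
    bounded_borel (eball eps) (fun h => v (x + h));
  supersolution_ge1 : forall y, thickening A eps y -> 1 <= v y;
  supersolution_step : forall x nu, A x -> sphere nu ->
    mean_step alpha beta eps v x nu <= kappa * v x
}.

Section barrier.
Context {R : realType} {n : nat}.
Variables (alpha beta eps M : R) (A : set 'rV[R]_n).
Hypotheses (n_ge2 : (2 <= n)%N) (alpha_gt0 : 0 < alpha) (beta_gt0 : 0 < beta).
Hypotheses (alphaDbeta : alpha + beta = 1) (eps_gt0 : 0 < eps).
Hypothesis A_bounded : forall x, A x -> enorm x <= M.

Let c := favg eps (0 : 'rV[R]_n) (fun h => dotp h h).
Let lam := 2 / (beta * c).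
Let K := expR (lam * (3 * (M ^+ 2 + eps ^+ 2))).

Let c_gt0 : 0 < c. Proof. exact: favg_dotpxx_gt0. Qed.

Let lam_ge0 : 0 <= lam.
Proof. by rewrite divr_ge0// mulr_ge0// ltW. Qed.

Let K_ge1 : 1 <= K.
Proof. by rewrite -expR0 ler_expR mulr_ge0// mulr_ge0// addr_ge0 ?sqr_ge0. Qed.

Let exp_sqr_doubling (x nu : 'rV[R]_n) :
  2 * exp_sqr lam x <= mean_step alpha beta eps (exp_sqr lam) x nu.
Proof.
rewrite /mean_step; have := favg_exp_sqr_ge eps_gt0 lam_ge0 nu x.
rewrite (favg_dotpxx_indep _ nu 0) -/c => /(ler_wpM2l (ltW beta_gt0)).
rewrite [leLHS](_ : _ = beta * exp_sqr lam x + 2 * exp_sqr lam x); last first.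
  by rewrite /lam; field; rewrite !gt_eqF.
have : 0 <= alpha * exp_sqr lam (x + eps *: nu).
  by rewrite mulr_ge0 ?expR_ge0// ltW.
have : 0 <= beta * exp_sqr lam x by rewrite mulr_ge0 ?expR_ge0// ltW.
lra.
Qed.

Lemma strict_supersolution_exists :
  exists kappa v,
    0 <= kappa < 1 /\ strict_supersolution alpha beta eps A kappa v.
Proof.
exists (1 - (2 * K)^-1), (fun x => 2 * K + (-1) * exp_sqr lam x).
have K_gt0 : 0 < K by exact: lt_le_trans K_ge1.
have K2_gt0 : 0 < 2 * K by rewrite mulr_gt0.
have K2_ge1 : 1 <= 2 * K by have := K_ge1; lra.
have rexp x := bounded_borel_exp_sqr eps_gt0 lam_ge0 x.
have rcst := bounded_borel_cst (2 * K) (@measurable_eball R n _ eps_gt0).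
split; first by rewrite subr_ge0 invf_le1// K2_ge1 gtrBl invr_gt0.
split=> [x _|_ [x Ax [h he <-]]|x nu Ax nu1].
- exact/bounded_borelD/bounded_borelZ.
- have := exp_sqr_shift_le lam_ge0 (A_bounded Ax) he; rewrite -/K.
  by have := K_ge1; lra.
rewrite mean_stepD//; last exact: bounded_borelZ.
rewrite mean_step_cst// mean_stepZ//.
have -> : (1 - (2 * K)^-1) * (2 * K + -1 * exp_sqr lam x) =
  2 * K - exp_sqr lam x - 1 + exp_sqr lam x / (2 * K) by field; rewrite gt_eqF.
have : 0 <= exp_sqr lam x / (2 * K) by rewrite divr_ge0 ?expR_ge0// ltW.
have := exp_sqr_doubling x nu; have := exp_sqr_ge1 lam_ge0 x; lra.
Qed.

End barrier.

Section boundary_layer.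
Context {R : realType} {n : nat}.
Implicit Types (Om A B : set 'rV[R]_n) (x h : 'rV[R]_n).

Lemma connected_meets_bdry A B : connected A ->
  A `&` B !=set0 -> A `&` ~` B !=set0 -> A `&` bdry B !=set0.
Proof.
move=> cA [a [Aa Ba]] [b [Ab nBb]]; apply: contrapT => nAB.
have clB y : A y -> closure B y -> interior B y.
  by move=> Ay By; apply: contrapT => nBy; apply: nAB; exists y.
suff AE : A `&` closure B = A.
  have [_ clBb] : (A `&` closure B) b by rewrite AE.
  by apply: nBb; apply: interior_subset; exact: clB.
apply: cA.
- by exists a; split=> //; exact: subset_closure.
- exists (interior B); first exact: open_interior.
  apply/seteqP; split=> y [Ay By]; split=> //; first exact: clB.
  by apply: subset_closure; exact: interior_subset.
- by exists (closure B) => //; exact: closed_closure.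
Qed.

Lemma segment_meets_bdry Om x h : Om x -> ~ Om (x + h) ->
  exists2 t : R, 0 <= t <= 1 & bdry Om (x + t *: h).
Proof.
move=> Omx nOm; pose line t : 'rV[R]_n := x + t *: h.
have cline : continuous line.
  by move=> t; apply: cvgD; [exact: cvg_cst|apply: cvgZr_tmp; exact: cvg_id].
have cL : connected (line @` `[0, 1]).
  apply: connected_continuous_connected; first exact: segment_connected.
  exact: continuous_subspaceT.
have [||_ [[t t01 <-] bt]] := @connected_meets_bdry _ Om cL.
- exists x; split=> //; exists 0; first by rewrite /= in_itv/= lexx ler01.
  by rewrite /line scale0r addr0.
- exists (x + h); split=> //; exists 1; first by rewrite /= in_itv/= lexx ler01.
  by rewrite /line scale1r.
by exists t => //; move: t01; rewrite /= in_itv.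
Qed.

Lemma dist_le_enorm x y A : A y -> dist x A <= enorm (x - y).
Proof.
move=> Ay; apply: ge_inf; last by exists y.
by exists 0 => _ [z _ <-]; exact: enorm_ge0.
Qed.

Lemma dist_ge0 x A : 0 <= dist x A.
Proof.
have [->|/set0P A0] := eqVneq A set0; first by rewrite /dist image_set0 inf0.
apply: lb_le_inf; first exact: image_nonempty.
by move=> _ [y _ <-]; exact: enorm_ge0.
Qed.

Lemma thickening_sub_Omegaeps Om (eps : R) : open Om -> 0 < eps ->
  thickening Om eps `<=` Omegaeps Om eps.
Proof.
move=> oOm e0 _ [x Omx [h he <-]].
have [cl|ncl] := pselect (closure Om (x + h)); [by left|right; split=> //].
have nOm : ~ Om (x + h) by move=> /subset_closure.
have [t /andP[t0 t1] bt] := segment_meets_bdry Omx nOm.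
have {}t0 : 0 < t.
  rewrite lt_neqAle t0 andbT; apply/eqP => t0'; case: bt => _; apply.
  by rewrite -t0' scale0r addr0; exact: open_nbhs_nbhs.
apply: le_lt_trans (dist_le_enorm (x + h) bt) _.
have -> : x + h - (x + t *: h) = (1 - t) *: h.
  by rewrite opprD addrACA subrr add0r scalerBl scale1r.
rewrite enormZ ger0_norm ?subr_ge0//.
apply: (@le_lt_trans _ _ ((1 - t) * eps)).
  by rewrite ler_wpM2l// subr_ge0.
by rewrite gtr_pMl// gtrBl.
Qed.

Lemma subset_thickening Om (eps : R) : 0 <= eps ->
  Om `<=` thickening Om eps.
Proof.
by move=> e0 x Omx; exists x => //; exists 0; rewrite ?addr0//= enorm0.
Qed.

Lemma Omegaeps_outside Om (eps : R) : open Om ->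
  Omegaeps Om eps `\` Om `<=` Oeps Om eps `|` bdry Om.
Proof.
move=> oOm x [[clx|Ox] nOm]; [right|by left].
by split=> // /interior_subset.
Qed.

Lemma deltabar_outside Om (eps : R) x :
  open Om -> Omegaeps Om eps x -> ~ Om x -> deltabar Om eps x = 1.
Proof.
move=> oOm xO nOm; rewrite /deltabar memNset; last by case.
by rewrite mem_set//; exact: Omegaeps_outside.
Qed.

Lemma deltabar_itv Om (eps : R) x : 0 < eps -> 0 <= deltabar Om eps x <= 1.
Proof.
move=> e0; rewrite /deltabar; case: ifPn => [|_]; last first.
  by case: ifPn; rewrite ?lexx ?ler01.
rewrite inE => -[_ /ltW xe]; rewrite subr_ge0 ler_pdivrMr// mul1r xe/=.
by rewrite gerBl divr_ge0 ?dist_ge0// ltW.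
Qed.

Lemma mem_IepsT Om (eps t : R) x : eps ^+ 2 / 2 <= t ->
  ((x, t) \in IepsT Om eps t) = (x \in Ieps Om eps).
Proof.
move=> et; apply/idP/idP; rewrite !inE /IepsT/= => -[].
- by case=> Omx [_ xe].
- by case=> _ /andP[_]; rewrite ltNge et.
- by move=> Omx xe; left; rewrite et lexx.
Qed.

Lemma mem_OepsT_parbdry Om (eps t : R) x : 0 < t ->
  ((x, t) \in OepsT Om eps t `|` parbdry Om t) =
  (x \in Oeps Om eps `|` bdry Om).
Proof.
move=> t0; apply/idP/idP; rewrite !inE /OepsT /parbdry/=.
- case=> [[[ncl [xe _]]|[_ /andP[_]]]|[[_ t0']|[bx _]]].
  + by left; split.
  + by rewrite ltNge (ltW t0).
  + by move: t0; rewrite t0' ltxx.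
  + by right.
- by case=> [[ncl xe]|bx]; [left; left|right; right]; rewrite t0 lexx.
Qed.

Lemma delta_deltabar Om (eps t : R) x : 0 < eps -> eps ^+ 2 < t ->
  delta Om eps t x t = deltabar Om eps x.
Proof.
move=> e0 et; have e20 : 0 < eps ^+ 2 by rewrite exprn_gt0.
rewrite /delta /deltabar mem_IepsT ?mem_OepsT_parbdry; try by lra.
case: ifPn => //; rewrite inE => -[_ /ltW xe]; congr (1 - _).
rewrite (min_r (x := 1) (y := dist x _ / eps)) ?ler_pdivrMr ?mul1r//.
rewrite min_l ?mulr1// ler_pdivlMr// mul1r -[leLHS]gtr0_norm// -sqrtr_sqr.
by rewrite ler_wsqrtr//; lra.
Qed.

Lemma Omegaeps_OmegaepsT Om (eps t : R) x : 0 < t ->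
  Omegaeps Om eps x -> OmegaepsT Om eps t (x, t).
Proof.
move=> t0 [clx|[ncl xe]]; last by right; left; rewrite /= t0 lexx.
left => B [[P Q] /= [xP tQ] PQB].
have [y [Omy Py]] := clx _ xP.
exists (y, t); split; first by split; rewrite //= t0 lexx.
by apply: PQB; split => //=; exact: nbhs_singleton.
Qed.

End boundary_layer.

Definition stationary_dpp {R : realType} {n} (alpha beta eps : R)
    (Om : set 'rV[R]_n) (psi f : 'rV[R]_n -> R) (x : 'rV[R]_n) : R :=
  (1 - deltabar Om eps x) *
    midrange [set mean_step alpha beta eps f x nu | nu in @sphere R n]
  + deltabar Om eps x * psi x.

Lemma parabolic_dpp_stationary {R : realType} {n} (alpha beta eps t : R)
    (Om : set 'rV[R]_n) (psi : 'rV[R]_n -> R) (phi u : 'rV[R]_n -> R -> R)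
    (x : 'rV[R]_n) : 0 < eps -> eps ^+ 2 < t ->
  (1 - delta Om eps t x t) * midrange
      [set Aeps alpha beta eps u x (t - eps ^+ 2 / 2) nu | nu in @sphere R n]
    + delta Om eps t x t * Fdat eps psi phi x t =
  stationary_dpp alpha beta eps Om psi (u^~ (t - eps ^+ 2 / 2)) x.
Proof. by move=> e0 et; rewrite delta_deltabar// /Fdat et. Qed.

Lemma stationary_dpp_contraction {R : realType} {n} (alpha beta eps kappa m : R)
    (Om : set 'rV[R]_n) (psi f g v : 'rV[R]_n -> R) :
  (0 < n)%N -> 0 < alpha -> 0 < beta -> alpha + beta = 1 -> 0 < eps ->
  open Om -> 0 <= kappa -> strict_supersolution alpha beta eps Om kappa v ->
  bounded_borel (Omegaeps Om eps) f -> bounded_borel (Omegaeps Om eps) g ->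
  (forall y, thickening Om eps y -> `|f y - g y| <= m * v y) ->
  forall y, thickening Om eps y ->
    `|stationary_dpp alpha beta eps Om psi f y
      - stationary_dpp alpha beta eps Om psi g y| <= kappa * m * v y.
Proof.
move=> n0 a0 b0 ab1 e0 oOm kap0 [vreg v1 vstep] bf bg fgv y Ny.
have m0 : 0 <= m.
  have v0 : 0 < v y by exact: lt_le_trans (v1 _ Ny).
  by rewrite -(pmulr_lge0 _ v0); exact: le_trans (fgv y Ny).
have Oy := thickening_sub_Omegaeps oOm e0 Ny.
have [Omy|nOmy] := pselect (Om y); last first.
  rewrite /stationary_dpp deltabar_outside// !(subrr, mul0r) normr0.
  by rewrite !mulr_ge0// (le_trans ler01)// v1.
have /andP[d0 d1] := deltabar_itv Om y e0.
rewrite /stationary_dpp opprD addrACA subrr addr0 -mulrBr normrM.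
rewrite ger0_norm ?subr_ge0//; apply: le_trans (ler_piMl _ _) _ => //.
  by rewrite gerBl.
have Nyh h : enorm h <= eps -> thickening Om eps (y + h).
  by move=> he; exists y => //; exists h.
apply: (@dist_midrange_mean_step_le _ _ _ _ _ m _ (Omegaeps Om eps) f g v) =>
  // [h /Nyh||h /Nyh|nu nu1].
- exact: thickening_sub_Omegaeps.
- exact: vreg.
- exact: fgv.
- by rewrite mulrAC [leRHS]mulrC ler_wpM2l// vstep.
Qed.

Lemma delayed_contraction_cvg {R : realType} {X : Type} (N : set X)
    (t0 tau kappa m : R) (u : X -> R -> R) (U v : X -> R) :
  0 < tau -> 0 <= kappa < 1 ->
  (forall t y, t0 < t -> N y -> `|u y t - U y| <= m * v y) ->
  (forall t c, t0 < t - tau ->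
     (forall y, N y -> `|u y (t - tau) - U y| <= c * v y) ->
     forall y, N y -> `|u y t - U y| <= kappa * c * v y) ->
  forall y, N y -> u y t @[t --> +oo] --> U y.
Proof.
move=> tau0 /andP[kap0 kap1] base contract.
have decay j t y : t0 + j%:R * tau < t -> N y ->
    `|u y t - U y| <= kappa ^+ j * m * v y.
  elim: j t y => [|j IH] t y.
    by rewrite mul0r addr0 mul1r; exact: base.
  rewrite -natr1 mulrDl mul1r addrA -ltrBrDr => jt Ny.
  rewrite exprS -(mulrA kappa); apply: contract => // [|z]; last exact: IH.
  by apply: le_lt_trans jt; rewrite lerDl mulr_ge0// ltW.
move=> y Ny; apply/cvgrPdist_lt => e e0.
have : (fun j => kappa ^+ j * (m * v y)) @ \oo --> (0 : R).
  rewrite -[X in _ --> X](mul0r (m * v y)); apply: cvgMl.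
  by apply: cvg_expr; rewrite ger0_norm.
move=> /cvgrPdist_lt/(_ e e0)[j _ /(_ j (leqnn j))] /=.
rewrite sub0r normrN => je.
exists (t0 + j%:R * tau); split=> [|t jt]; first exact: num_real.
rewrite distrC; apply: le_lt_trans (decay j t y jt Ny) _.
by rewrite -mulrA; apply: le_lt_trans je; exact: ler_norm.
Qed.

Lemma stationary_dpp_iteration_cvg {R : realType} {n}
    (alpha beta eps t0 tau : R) (Om : set 'rV[R]_n) (psi : 'rV[R]_n -> R)
    (u : 'rV[R]_n -> R -> R) (U : 'rV[R]_n -> R) :
  (2 <= n)%N -> 0 < alpha -> 0 < beta -> alpha + beta = 1 -> 0 < eps ->
  open Om -> (exists M : R, forall x, Om x -> enorm x <= M) -> 0 < tau ->
  (exists C, forall t y, t0 < t -> Omegaeps Om eps y -> `|u y t| <= C) ->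
  (forall t, t0 < t -> borel_on (Omegaeps Om eps) (u^~ t)) ->
  (forall t y, t0 + tau < t -> Omegaeps Om eps y ->
     u y t = stationary_dpp alpha beta eps Om psi (u^~ (t - tau)) y) ->
  bounded_borel (Omegaeps Om eps) U ->
  (forall y, Omegaeps Om eps y ->
     U y = stationary_dpp alpha beta eps Om psi U y) ->
  forall x, Om x -> u x t @[t --> +oo] --> U x.
Proof.
move=> n2 a0 b0 ab1 e0 oOm [M OmM] tau0 [C uC] ub ueq bU Ueq x Omx.
have [kappa [v [kappa01 sv]]] :=
  strict_supersolution_exists n2 a0 b0 ab1 e0 OmM.
have N_Om := thickening_sub_Omegaeps oOm e0.
have [_ [C' UC']] := bU.
apply: (@delayed_contraction_cvg _ _ (thickening Om eps) t0 tau kappa (C + C')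
  u U v) => //.
- move=> t y t0t /[dup] Ny /N_Om Oy.
  have uU : `|u y t - U y| <= C + C'.
    by rewrite (le_trans (ler_normB _ _))// lerD ?UC' ?uC.
  apply: (le_trans uU); rewrite ler_peMr ?(supersolution_ge1 sv)//.
  exact: le_trans uU.
- move=> t c t0t uUc y Ny; have Oy := N_Om _ Ny.
  rewrite ueq ?[U y]Ueq//; last by rewrite -ltrBrDr.
  apply: (@stationary_dpp_contraction _ _ _ _ _ _ _ _ _
    (u^~ (t - tau)) U v) => //.
  + exact: ltnW.
  + by case/andP: kappa01.
  + by split; [exact: ub|exists C => z; exact: uC].
- exact: subset_thickening (ltW e0) _ Omx.
Qed.

Theorem theorem4p2 (R : realType) (n : nat) (alpha beta eps : R)
    (Om : set 'rV[R]_n) (psi : 'rV[R]_n -> R) (phi : 'rV[R]_n -> R -> R)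
    (u : 'rV[R]_n -> R -> R) (U : 'rV[R]_n -> R) :
  (2 <= n)%N ->
  0 < alpha -> 0 < beta -> alpha + beta = 1 ->
  (* Om is a bounded domain *)
  open Om -> connected Om -> Om !=set0 ->
  (exists M : R, forall x, Om x -> enorm x <= M) ->
  0 < eps ->
  {within Gammaeps Om eps, continuous psi} ->
  {within Omegaeps Om eps `*` `[- (eps ^+ 2 / 2), eps ^+ 2 / 2],
     continuous (fun p : 'rV[R]_n * R => phi p.1 p.2)} ->
  (* u = u_eps : the bounded (Borel) solution of the parabolic DPP on every Omega_{eps,T} *)
  (exists M : R, forall T x t, eps ^+ 2 < T -> OmegaepsT Om eps T (x, t) -> `|u x t| <= M) ->
  (forall t, - (eps ^+ 2 / 2) < t -> borel_on (Omegaeps Om eps) (fun x => u x t)) ->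
  (forall T x t, eps ^+ 2 < T -> OmegaepsT Om eps T (x, t) ->
     u x t = (1 - delta Om eps T x t)
               * midrange [set Aeps alpha beta eps u x (t - eps ^+ 2 / 2) nu | nu in @sphere R n]
             + delta Om eps T x t * Fdat eps psi phi x t) ->
  (* U = U_eps : the bounded (Borel) solution of the stationary DPP on Omega_eps *)
  (exists M : R, forall x, Omegaeps Om eps x -> `|U x| <= M) ->
  borel_on (Omegaeps Om eps) U ->
  (forall x, Omegaeps Om eps x ->
     U x = (1 - deltabar Om eps x)
             * midrange [set alpha * U (x + eps *: nu)
                             + beta * favg eps nu (fun h => U (x + h)) | nu in @sphere R n]
           + deltabar Om eps x * psi x) ->
  forall x, Om x -> u x T @[T --> +oo] --> U x.
Proof.
move=> n2 a0 b0 ab1 oOm _ _ Om_bounded e0 _ _ [Mu uM] ub ueq UM Ub Ueq.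
have e20 : 0 < eps ^+ 2 by rewrite exprn_gt0.
have in_cylinder t y : eps ^+ 2 < t -> Omegaeps Om eps y ->
    OmegaepsT Om eps t (y, t).
  by move=> et; apply: Omegaeps_OmegaepsT; exact: lt_trans et.
apply: (@stationary_dpp_iteration_cvg _ _ alpha beta eps (eps ^+ 2)
  (eps ^+ 2 / 2) Om psi) => //.
- by rewrite divr_gt0.
- by exists Mu => t y et Oy; apply: (uM t) => //; exact: in_cylinder.
- by move=> t et; apply: ub; lra.
- move=> t y et Oy; have {}et : eps ^+ 2 < t by lra.
  rewrite (ueq t y t et); last exact: in_cylinder.
  exact: parabolic_dpp_stationary.
Qed.
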